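(* Let $\mathfrak g=\mathfrak{gl}(2|2)$ and $\mathfrak k=\mathfrak{gl}(1|1)\oplus\mathfrak{gl}(1|1)$. For every $\lambda\in\mathscr H(1,1)$ the irreducible $\mathfrak g$-module $V_\lambda$ is $\mathfrak k$-spherical.
   Context: Ground field $\mathbb C$. $\mathfrak g=\mathfrak{gl}(2|2)$ with matrix units $E_{a,b}$, indices $1,2$ even and $3,4$ odd. $\mathfrak k$ is the span of the diagonal matrices together with $E_{13},E_{31},E_{24},E_{42}$ (the first copy of $\mathfrak{gl}(1|1)$ acts on coordinates $\{1,3\}$, the second on $\{2,4\}$). $\epsilon^+,\epsilon^-,\delta^+,\delta^-$ are the diagonal coordinate functions at positions $1,2,3,4$ on the diagonal Cartan subalgebra $\mathfrak t$. $\mathscr H(1,1)$ is the set of $(1,1)$-hook partitions $\lambda$, i.e. those with $\lambda_2\le 1$: $\lambda=\varnothing$ or $\lambda=(a,1^b)$ with $a\ge1$, $b\ge0$ (put $a=b=0$ for $\lambda=\varnothing$). $\mathfrak b_\natural^-$ is the Borel subalgebra containing $\mathfrak t$ with simple roots $\epsilon^--\delta^-,\ \delta^--\delta^+,\ \delta^+-\epsilon^+$. $V_\lambda$ is the irreducible $\mathfrak g$-module with $\mathfrak b_\natural^-$-highest weight $a(\epsilon^--\epsilon^+)+b(\delta^--\delta^+)$. A $\mathfrak g$-module $V$ is $\mathfrak k$-spherical if $V^{\mathfrak k}=\{v\in V:X.v=0\ \forall X\in\mathfrak k\}\neq0$. *)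

(* Defs.v *)
From HB Require Import structures.
From mathcomp Require Import all_boot all_order all_algebra.
From mathcomp Require Import reals.
From mathcomp Require Export complex.

Set Implicit Arguments.
Unset Strict Implicit.
Unset Printing Implicit Defensive.

Import GRing.Theory.
Local Open Scope ring_scope.
Local Open Scope complex_scope.

(* The field of complex numbers is [R[i]] for [R : realType].  Coordinates
   numbered 1, 2 (even) and 3, 4 (odd) are the ordinals 0, 1, 2, 3 of ['I_4]. *)

Section GL22.
Variable R : realType.
Local Notation C := R[i].

Definition pos1 : 'I_4 := @Ordinal 4 0 isT.
Definition pos2 : 'I_4 := @Ordinal 4 1 isT.
Definition pos3 : 'I_4 := @Ordinal 4 2 isT.
Definition pos4 : 'I_4 := @Ordinal 4 3 isT.

Definition parity (i : 'I_4) : bool := (2 <= i)%N.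

Definition E (i j : 'I_4) : 'M[C]_4 := delta_mx i j.

Definition homogeneous (p : bool) (X : 'M[C]_4) : Prop :=
  forall i j, parity i (+) parity j != p -> X i j = 0.

(* The superbracket of X and Y, homogeneous of respective parities p and q. *)
Definition sbracket (p q : bool) (X Y : 'M[C]_4) : 'M[C]_4 :=
  X *m Y - (-1) ^+ (p && q) *: (Y *m X).

(* The super vector space V = V_0 (+) V_1 is the product of its even part and
   its odd part; no dimension restriction is imposed. *)
Record gl22_module := Gl22Module {
  even_part : lmodType C;
  odd_part : lmodType C;
  act : 'M[C]_4 -> even_part * odd_part -> even_part * odd_part;
  act_linear_l : forall v, linear (fun X => act X v);
  act_linear_r : forall X, linear (act X);
  act_even : forall X, homogeneous false X ->
    (forall v, (act X (v, 0)).2 = 0) /\ (forall w, (act X (0, w)).1 = 0);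
  act_odd : forall X, homogeneous true X ->
    (forall v, (act X (v, 0)).1 = 0) /\ (forall w, (act X (0, w)).2 = 0);
  act_bracket : forall p q X Y v, homogeneous p X -> homogeneous q Y ->
    act (sbracket p q X Y) v =
      act X (act Y v) - (-1) ^+ (p && q) *: act Y (act X v)
}.

Definition carrier (V : gl22_module) : lmodType C :=
  (even_part V * odd_part V)%type.

Record graded_submodule (V : gl22_module) (U : carrier V -> Prop) : Prop := {
  sub_zero : U 0;
  sub_linear : forall (c : C) u v, U u -> U v -> U (c *: u + v);
  (* the odd component follows by subtraction *)
  sub_graded : forall v, U v -> U (v.1, 0);
  sub_act : forall X v, U v -> U (act X v)
}.

Definition irreducible (V : gl22_module) : Prop :=
  (exists v : carrier V, v != 0) /\
  forall U : carrier V -> Prop, graded_submodule U ->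
    (forall v, U v -> v = 0) \/ (forall v, U v).

(* A weight of the diagonal Cartan subalgebra is given by its coordinates in the
   dual basis (eps^+, eps^-, delta^+, delta^-). *)
Definition weight := 'rV[C]_4.

Definition coordinate (i : 'I_4) : weight := delta_mx 0 i.
Definition eps_plus : weight := coordinate pos1.
Definition eps_minus : weight := coordinate pos2.
Definition delta_plus : weight := coordinate pos3.
Definition delta_minus : weight := coordinate pos4.

(* The roots are the weights of the E i j with i != j. *)
Definition root_of (i j : 'I_4) : weight := coordinate i - coordinate j.

Definition positive (al : weight) : Prop :=
  exists c1 c2 c3 : nat,
    al = (eps_minus - delta_minus) *+ c1 + (delta_minus - delta_plus) *+ c2
         + (delta_plus - eps_plus) *+ c3.

(* The Borel subalgebra b_natural^-: the Cartan subalgebra plus the positive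
   root spaces. *)
Definition borel (X : 'M[C]_4) : Prop :=
  forall i j, X i j != 0 -> i = j \/ positive (root_of i j).

(* The diagonal acts on v through mu, and the positive root spaces kill v.
   Homogeneity of v is not required: the two components of v satisfy the same
   equations. *)
Definition highest_weight_vector (V : gl22_module) (mu : weight)
    (v : carrier V) : Prop :=
  v != 0 /\
  forall X, borel X -> act X v = (\sum_i mu 0 i * X i i) *: (v : carrier V).

Definition has_highest_weight (V : gl22_module) (mu : weight) : Prop :=
  exists v : carrier V, highest_weight_vector mu v.

Definition k_sub : {vspace 'M[C]_4} :=
  <<[:: E pos1 pos1; E pos2 pos2; E pos3 pos3; E pos4 pos4;
        E pos1 pos3; E pos3 pos1; E pos2 pos4; E pos4 pos2]>>%VS.

Definition k_spherical (V : gl22_module) : Prop :=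
  exists v : carrier V, v != 0 /\ forall X, X \in k_sub -> act X v = 0.

(* For la = (a, 1^b), a is the first part and b the number of other parts; both
   are 0 for the empty partition. *)
Definition hook_weight (la : seq nat) : weight :=
  (eps_minus - eps_plus) *+ nth 0%N la 0
  + (delta_minus - delta_plus) *+ (size la).-1.

Definition is_V (la : seq nat) (V : gl22_module) : Prop :=
  irreducible V /\ has_highest_weight V (hook_weight la).

End GL22.

(* A partition is the weakly decreasing list of its nonzero parts. *)
Definition is_partition (la : seq nat) : bool :=
  sorted geq la && (0%N \notin la).

Definition hook11 (la : seq nat) : bool :=
  is_partition la && (nth 0%N la 1 <= 1)%N.

(* Main.v *)
Require Import Defs.
From HB Require Import structures.
From mathcomp Require Import all_boot all_order all_algebra.
From mathcomp Require Import reals.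
From mathcomp Require Import ring.

(** Order the coordinates as 2, 4, 3, 1.  Then [k] is the Levi subalgebra of the
    grading of [g] by the trace of the block {2, 4}; let [n+] and [n-] be its
    parts of degree 1 and -1.  Write x, y (even) and xi, eta (odd) for the root
    vectors of [n-], and e1, f1, e2, f2 for the odd root vectors of [k].  The
    highest weight vector [w] has degree [d = a + b], and every vector of weight
    zero has degree 0.  On a vector of weight zero the identities of both copies
    of gl(1|1) vanish, so e1, f1, e2, f2 act through an exterior algebra and
    [f1 f2 e1 e2] sends any vector of weight zero to a [k]-invariant
    ([exterior_top_invariant]).

    Apply this to [x^a y^b w], which is nonzero by sl2 theory.  The result is
    an explicit combination of six monomials, and raising it [a] times with the
    root vector opposite to x multiplies [y^b w] by a nonzero constant times
    [d (a - b - 1)] ([raise_typical]).  Hence the invariant is nonzero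
    unless [a = b + 1], which for [d > 0] is exactly the atypicality condition
    on the highest weight.

    When [a = b + 1], this vector vanishes, but [V] is much smaller.  In
    an irreducible module a vector of lower degree killed by [n+] is zero
    ([no_singular]), and this forces
    - [d xi w = - y f2 w] and [d eta w = y f1 w],
    - [xi f1 f2 w = x f2 w] and [eta f1 f2 w = - x f1 w].
    So each of e1, f1, e2, f2 maps the two vectors [x^a y^b w] and
    [x^(a-1) y^(b+1) f1 f2 w] to the same line, and with these relations all four
    kill the combination [d x^a y^b w - x^(a-1) y^(b+1) f1 f2 w].

    For the empty partition, the same vanishing principle applied to the full
    Borel grading gives [f1 w = f2 w = 0], so [w] itself is invariant. *)

Set Implicit Arguments.
Unset Strict Implicit.
Unset Printing Implicit Defensive.

Import Order.TTheory GRing.Theory Num.Theory.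
Local Open Scope ring_scope.

(** * Powers of operators *)

Section IteratedOperators.
Variables (K : numFieldType) (M : lmodType K).

Fact iter_is_linear n (f : {linear M -> M}) : linear (iter n f).
Proof. by move=> c u v; elim: n => //= n ->; rewrite linearP. Qed.

HB.instance Definition _ n (f : {linear M -> M}) :=
  GRing.isLinear.Build K M M *:%R (iter n f) (iter_is_linear n f).

Lemma commute_iter (f g : {linear M -> M}) n v :
  (forall u, f (g u) = g (f u)) -> f (iter n g v) = iter n g (f v).
Proof. by move=> fg; elim: n => //= n IHn; rewrite fg IHn. Qed.

(** The Leibniz rule when the commutator of [f] and [g] is a multiple of an
    operator [h] commuting with [g].  The predecessor in the exponent is harmless
    at [n = 0], where the coefficient vanishes. *)
Lemma derive_iter (f g h : {linear M -> M}) (s : K) n v :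
    (forall u, f (g u) = g (f u) + s *: h u) ->
    (forall u, h (g u) = g (h u)) ->
  f (iter n g v) = iter n g (f v) + (s * n%:R) *: iter n.-1 g (h v).
Proof.
move=> fg hg; elim: n => [|n IHn] /=; first by rewrite mulr0 scale0r addr0.
rewrite fg {}IHn (commute_iter _ _ hg) linearD linearZ_LR -addrA /=; congr (_ + _).
case: n => [|n] /=; first by rewrite !mulr0 scale0r add0r mulr1.
by rewrite -scalerDl -[in RHS]addn1 natrD mulrDr mulr1.
Qed.

End IteratedOperators.

(** * Strings of sl2 *)

Section Sl2.
Variables (K : numFieldType) (M : lmodType K) (T X H : {linear M -> M}).
Hypothesis TX : forall v, T (X v) = X (T v) + H v.
Hypothesis HX : forall v, H (X v) = X (H v) - 2 *: X v.
Hypothesis HT : forall v, H (T v) = T (H v) + 2 *: T v.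

Lemma weight_lower n (m : K) u :
  H u = m *: u -> H (iter n X u) = (m - n.*2%:R) *: iter n X u.
Proof.
move=> Hu; elim: n => [|n IHn] /=; first by rewrite subr0.
rewrite HX IHn linearZ_LR -scalerBl doubleS -addn2 natrD; congr (_ *: _); ring.
Qed.

Lemma weight_raise n (m : K) u :
  H u = m *: u -> H (iter n T u) = (m + n.*2%:R) *: iter n T u.
Proof.
move=> Hu; elim: n => [|n IHn] /=; first by rewrite addr0.
rewrite HT IHn linearZ_LR -scalerDl doubleS -addn2 natrD; congr (_ *: _); ring.
Qed.

(** Commuting [T^(k+1)] with [X] only costs a multiple of [T^k], so each factor
    [X] delays the vanishing under [T] by one step. *)
Lemma raise_lower_nilp n k (m : K) u :
  H u = m *: u -> iter k T u = 0 -> iter (n + k) T (iter n X u) = 0.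
Proof.
elim: n u k m => [|n IHn] u k m Hu Tu //.
rewrite addSnnS iterSr.
apply: (IHn (X u) k.+1 (m - 2)).
  by rewrite HX Hu linearZ_LR -scalerBl.
suff [c ->]: exists c : K, iter k.+1 T (X u) = X (T (iter k T u)) + c *: iter k T u.
  by rewrite Tu scaler0 addr0 linear0 linear0.
elim: k {Tu} => [|k [c IHk]]; first by exists m; rewrite /= TX Hu.
exists (m + k.+1.*2%:R + c).
rewrite [LHS]/= -/(iter k.+1 T (X u)) IHk linearD TX linearZ_LR -[T (iter k T u)]/(iter k.+1 T u).
by rewrite (weight_raise _ Hu) -addrA -scalerDl.
Qed.

(** The scalar by which [T^n X^n] acts on a highest weight vector of weight [m]. *)
Definition ladder n (m : K) := \prod_(i < n) (i.+1%:R * (m - i%:R)).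

Lemma ladder0 m : ladder 0 m = 1.
Proof. by rewrite /ladder big_ord0. Qed.
Lemma ladder1 m : ladder 1 m = m.
Proof. by rewrite /ladder big_ord1 mul1r subr0. Qed.
Lemma ladder2 m : ladder 2 m = m * (2 * (m - 1)).
Proof. by rewrite /ladder big_ord_recr /= big_ord1 mul1r subr0. Qed.

Lemma ladder_neq0 n m : (n <= m)%N -> ladder n m%:R != 0.
Proof.
move=> le_nm; apply/prodf_neq0 => i _.
rewrite mulf_neq0 ?pnatr_eq0 // subr_eq0 eqr_nat gtn_eqF //.
exact: leq_trans le_nm.
Qed.

Lemma raise_lower n (m : K) u :
  H u = m *: u -> T u = 0 -> iter n T (iter n X u) = ladder n m *: u.
Proof.
move=> Hu Tu.
have TXn i : T (iter i.+1 X u) = (i.+1%:R * (m - i%:R)) *: iter i X u.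
  elim: i => [|i IHi]; first by rewrite /= TX Tu linear0 add0r Hu mul1r subr0.
  rewrite [iter _ _ _]/= TX -/(iter i.+1 X u) IHi (weight_lower _ Hu) linearZ_LR -scalerDl.
  congr (_ *: _); rewrite -addnn natrD; rewrite !mulrSr; ring.
elim: n => [|n IHn]; first by rewrite /ladder big_ord0 scale1r.
by rewrite [LHS]iterSr TXn linearZ_LR /= IHn /ladder big_ord_recr scalerA mulrC.
Qed.

(** Raising a vector of weight [2m] from weight zero up to weight [2(m + k)] only
    sees its component along [X^k T^k u]: after subtracting it, the rest is killed
    by [T^k] and [raise_lower_nilp] applies. *)
Lemma raise_lower_top m k u :
    H u = m.*2%:R *: u -> iter k.+1 T u = 0 ->
  iter (m + k) T (iter m X u) =
    (ladder (m + k) (m + k).*2%:R / ladder k (m + k).*2%:R) *: iter k T u.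
Proof.
move=> Hu Tu; set v := iter k T u; set N := (m + k).*2%:R.
have Tv : T v = 0 by [].
have Hv : H v = N *: v by rewrite /N doubleD natrD (weight_raise _ Hu).
have lk : ladder k N != 0.
  by rewrite ladder_neq0 // -addnn (leq_trans (leq_addl m k)) ?leq_addl.
pose u' := u - (ladder k N)^-1 *: iter k X v.
have Hu' : H u' = m.*2%:R *: u'.
  rewrite linearB linearZ_LR Hu (weight_lower _ Hv) scalerBr !scalerA.
  by congr (_ - _ *: _); rewrite /N doubleD natrD addrK mulrC.
have Tu' : iter k T u' = 0.
  by rewrite linearB linearZ_LR /= (raise_lower _ Hv Tv) scalerA mulVf // scale1r subrr.
have Du : u = u' + (ladder k N)^-1 *: iter k X v by rewrite subrK.
clearbody u'; rewrite Du !linearD /= (raise_lower_nilp _ Hu' Tu') add0r.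
rewrite !linearZ_LR /= -iterD.
by rewrite (raise_lower _ Hv Tv) scalerA mulrC.
Qed.

End Sl2.

(** * Commutation relations of gl(2|2) *)

Section Gl22Operators.
Variables (K : numFieldType) (M : lmodType K).
Variable op : 'I_4 -> 'I_4 -> {linear M -> M}.

(** The superbracket relations of the matrix units, without any grading on the
    space acted upon: the explicit computations below do not use parities of
    vectors. *)
Definition gl22_relations := forall i j k l v,
  let s : K := (-1) ^+ ((parity i (+) parity j) && (parity k (+) parity l)) in
  op i j (op k l v) = s *: op k l (op i j v)
    + ((j == k)%:R *: op i l v - (s * (l == i)%:R) *: op k j v).

Hypothesis rel : gl22_relations.

(* Root vectors of [n-]. *)
Local Notation x := (op pos1 pos2).
Local Notation y := (op pos3 pos4).
Local Notation xi := (op pos1 pos4).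
Local Notation eta := (op pos3 pos2).
(* Root vectors of [n+]; [tx] and [ty] form sl2 triples with [x] and [y]. *)
Local Notation tx := (op pos2 pos1).
Local Notation ty := (op pos4 pos3).
Local Notation sg := (op pos4 pos1).
Local Notation ta := (op pos2 pos3).
(* Odd root vectors of [k]; those named [e] belong to the Borel subalgebra. *)
Local Notation e1 := (op pos2 pos4).
Local Notation f1 := (op pos4 pos2).
Local Notation e2 := (op pos3 pos1).
Local Notation f2 := (op pos1 pos3).

Local Ltac unit_rel :=
  by intros; rewrite rel /= ?(expr0, expr1, mulr0, mulr1) ?scale0r ?scale1r
    ?scaleN1r ?subr0 ?sub0r ?opprK ?addr0.

(* The fact named [p_q] moves [p] to the right of [q]. *)
Fact e1_x v : e1 (x v) = x (e1 v) - xi v.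
Proof. unit_rel. Qed.
Fact e1_y v : e1 (y v) = y (e1 v).
Proof. unit_rel. Qed.
Fact e1_eta v : e1 (eta v) = - eta (e1 v) + y v.
Proof. unit_rel. Qed.
Fact e1_f1 v : e1 (f1 v) = - f1 (e1 v) + (op pos2 pos2 v + op pos4 pos4 v).
Proof. unit_rel. Qed.
Fact e1_f2 v : e1 (f2 v) = - f2 (e1 v).
Proof. unit_rel. Qed.
Fact e1_e2 v : e1 (e2 v) = - e2 (e1 v).
Proof. unit_rel. Qed.
Fact e2_x v : e2 (x v) = x (e2 v) + eta v.
Proof. unit_rel. Qed.
Fact e2_y v : e2 (y v) = y (e2 v).
Proof. unit_rel. Qed.
Fact e2_f1 v : e2 (f1 v) = - f1 (e2 v).
Proof. unit_rel. Qed.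
Fact e2_f2 v : e2 (f2 v) = - f2 (e2 v) + (op pos3 pos3 v + op pos1 pos1 v).
Proof. unit_rel. Qed.
Fact f1_x v : f1 (x v) = x (f1 v).
Proof. unit_rel. Qed.
Fact f1_y v : f1 (y v) = y (f1 v) - eta v.
Proof. unit_rel. Qed.
Fact f1_xi v : f1 (xi v) = - xi (f1 v) + x v.
Proof. unit_rel. Qed.
Fact f1_eta v : f1 (eta v) = - eta (f1 v).
Proof. unit_rel. Qed.
Fact f1_f2 v : f1 (f2 v) = - f2 (f1 v).
Proof. unit_rel. Qed.
Fact f2_x v : f2 (x v) = x (f2 v).
Proof. unit_rel. Qed.
Fact f2_y v : f2 (y v) = y (f2 v) + xi v.
Proof. unit_rel. Qed.
Fact f2_f1 v : f2 (f1 v) = - f1 (f2 v).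
Proof. unit_rel. Qed.
Fact f2_xi v : f2 (xi v) = - xi (f2 v).
Proof. unit_rel. Qed.
Fact f2_eta v : f2 (eta v) = - eta (f2 v) + x v.
Proof. unit_rel. Qed.
Fact tx_x v : tx (x v) = x (tx v) + (op pos2 pos2 v - op pos1 pos1 v).
Proof. unit_rel. Qed.
Fact tx_y v : tx (y v) = y (tx v).
Proof. unit_rel. Qed.
Fact tx_xi v : tx (xi v) = xi (tx v) + e1 v.
Proof. unit_rel. Qed.
Fact tx_eta v : tx (eta v) = eta (tx v) - e2 v.
Proof. unit_rel. Qed.
Fact tx_f1 v : tx (f1 v) = f1 (tx v) - sg v.
Proof. unit_rel. Qed.
Fact tx_f2 v : tx (f2 v) = f2 (tx v) + ta v.
Proof. unit_rel. Qed.
Fact ty_x v : ty (x v) = x (ty v).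
Proof. unit_rel. Qed.
Fact ty_y v : ty (y v) = y (ty v) + (op pos4 pos4 v - op pos3 pos3 v).
Proof. unit_rel. Qed.
Fact ty_xi v : ty (xi v) = xi (ty v) - f2 v.
Proof. unit_rel. Qed.
Fact ty_eta v : ty (eta v) = eta (ty v) + f1 v.
Proof. unit_rel. Qed.
Fact ty_f1 v : ty (f1 v) = f1 (ty v).
Proof. unit_rel. Qed.
Fact ty_f2 v : ty (f2 v) = f2 (ty v).
Proof. unit_rel. Qed.
Fact sg_x v : sg (x v) = x (sg v) + f1 v.
Proof. unit_rel. Qed.
Fact sg_y v : sg (y v) = y (sg v) - e2 v.
Proof. unit_rel. Qed.
Fact sg_xi v : sg (xi v) = - xi (sg v) + (op pos4 pos4 v + op pos1 pos1 v).
Proof. unit_rel. Qed.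
Fact sg_eta v : sg (eta v) = - eta (sg v).
Proof. unit_rel. Qed.
Fact sg_f1 v : sg (f1 v) = - f1 (sg v).
Proof. unit_rel. Qed.
Fact sg_f2 v : sg (f2 v) = - f2 (sg v) + ty v.
Proof. unit_rel. Qed.
Fact ta_x v : ta (x v) = x (ta v) - f2 v.
Proof. unit_rel. Qed.
Fact ta_y v : ta (y v) = y (ta v) + e1 v.
Proof. unit_rel. Qed.
Fact ta_xi v : ta (xi v) = - xi (ta v).
Proof. unit_rel. Qed.
Fact ta_eta v : ta (eta v) = - eta (ta v) + (op pos2 pos2 v + op pos3 pos3 v).
Proof. unit_rel. Qed.
Fact ta_f1 v : ta (f1 v) = - f1 (ta v) + ty v.
Proof. unit_rel. Qed.
Fact ta_f2 v : ta (f2 v) = - f2 (ta v).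
Proof. unit_rel. Qed.
Fact xi_x v : xi (x v) = x (xi v).
Proof. unit_rel. Qed.
Fact xi_y v : xi (y v) = y (xi v).
Proof. unit_rel. Qed.
Fact eta_x v : eta (x v) = x (eta v).
Proof. unit_rel. Qed.
Fact eta_y v : eta (y v) = y (eta v).
Proof. unit_rel. Qed.
Fact eta_xi v : eta (xi v) = - xi (eta v).
Proof. unit_rel. Qed.
Fact y_x v : y (x v) = x (y v).
Proof. unit_rel. Qed.

Lemma ord4_cases (P : 'I_4 -> Prop) :
  P pos1 -> P pos2 -> P pos3 -> P pos4 -> forall i, P i.
Proof.
move=> P1 P2 P3 P4 [[|[|[|[|//]]]] lti]; [move: P1 | move: P2 | move: P3 | move: P4].
all: by congr P; apply: val_inj.
Qed.

Lemma op0 i j : op i j 0 = 0. Proof. exact: linear0. Qed.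
Lemma opN i j u : op i j (- u) = - op i j u. Proof. exact: linearN. Qed.
Lemma opD i j u v : op i j (u + v) = op i j u + op i j v. Proof. exact: linearD. Qed.
Lemma opZ i j c u : op i j (c *: u) = c *: op i j u. Proof. exact: linearZ. Qed.

Lemma odd_square i j v : i != j -> parity i (+) parity j -> op i j (op i j v) = 0.
Proof.
move=> ij pij; have := rel i j i j v; rewrite pij /= [j == i]eq_sym (negPf ij) expr1.
rewrite scaleN1r mulr0 !scale0r subr0 addr0 => /eqP; rewrite -addr_eq0 -mulr2n.
by rewrite -scaler_nat scaler_eq0 pnatr_eq0 => /eqP.
Qed.

Lemma op_diag i k l v :
  op i i (op k l v) = op k l (op i i v) + ((i == k)%:R - (i == l)%:R) *: op k l v.
Proof.
rewrite rel addbb /= expr0 scale1r mul1r scalerBl; congr (_ + (_ - _)).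
  by case: eqP => [->|_]; rewrite ?scale0r.
by rewrite eq_sym; case: eqP => [->|_]; rewrite ?scale0r.
Qed.

Definition has_weight (c : 'I_4 -> K) v := forall i, op i i v = c i *: v.

Lemma op_weight k l c v : has_weight c v ->
  has_weight (fun i => c i + ((i == k)%:R - (i == l)%:R)) (op k l v).
Proof. by move=> cv i; rewrite op_diag cv linearZ_LR -scalerDl. Qed.

Lemma iter_op_weight n k l c v : has_weight c v ->
  has_weight (fun i => c i + n%:R * ((i == k)%:R - (i == l)%:R)) (iter n (op k l) v).
Proof.
move=> cv; elim: n => [|n IHn] i /=; first by rewrite cv mul0r addr0.
by rewrite (op_weight k l IHn) -addrA -[in RHS]natr1 mulrDl mul1r.
Qed.

(** * Invariants from the exterior algebra *)

(** Both identity matrices of the two copies of gl(1|1) are central in [k]; where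
    they vanish, the odd root vectors of [k] anticommute. *)
Definition flat v :=
  op pos2 pos2 v + op pos4 pos4 v = 0 /\ op pos3 pos3 v + op pos1 pos1 v = 0.

(** The copies of gl(1|1) sit on the positions 1, 3 and 2, 4, whose ordinals are
    the even and the odd ones. *)
Definition in_k (i j : 'I_4) := odd i == odd j.

Lemma flat_op k l v : in_k k l -> flat v -> flat (op k l v).
Proof.
move=> kl [v24 v31].
suff s i j : (i == k)%:R - (i == l)%:R + ((j == k)%:R - (j == l)%:R) = 0 :> K ->
    op i i v + op j j v = 0 -> op i i (op k l v) + op j j (op k l v) = 0.
  split; apply: s => //; move: kl; elim/ord4_cases: k; elim/ord4_cases: l => //= _; ring.
move=> ijkl ij; rewrite !op_diag addrACA -linearD ij linear0 add0r.
by rewrite -scalerDl ijkl scale0r.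
Qed.

(** Flat vectors form a module over the exterior algebra on e1, f1, e2, f2; the
    product of its generators is killed by each of them, and has weight zero. *)
Lemma exterior_top_invariant v i j : has_weight (fun=> 0) v -> in_k i j ->
  op i j (f1 (f2 (e1 (e2 v)))) = 0.
Proof.
move=> v0 ij; have fv : flat v by split; rewrite !v0 !scale0r addr0.
have dv k : op k k (f1 (f2 (e1 (e2 v)))) = 0.
  rewrite (op_weight _ _ (op_weight _ _ (op_weight _ _ (op_weight _ _ v0)))).
  elim/ord4_cases: k => /=; rewrite -[RHS](scale0r (f1 (f2 (e1 (e2 v))))); congr (_ *: _); ring.
have fe2 := flat_op (isT : in_k pos3 pos1) fv.
have [f1e2 f2e2] := flat_op (isT : in_k pos2 pos4) fe2.
have [f1f2 _] := flat_op (isT : in_k pos1 pos3) (conj f1e2 f2e2).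
have e1e1 u : e1 (e1 u) = 0 by exact: odd_square.
have e2e2 u : e2 (e2 u) = 0 by exact: odd_square.
have f1f1 u : f1 (f1 u) = 0 by exact: odd_square.
have f2f2 u : f2 (f2 u) = 0 by exact: odd_square.
move: ij (dv i); elim/ord4_cases: i; elim/ord4_cases: j => // _ dvi; try exact: dvi.
- by rewrite f1_f2 opN f2f2 oppr0.
- by rewrite e1_f1 f1f2 addr0 e1_f2 e1e1 opN !op0 !oppr0.
- by rewrite e2_f1 e2_f2 f2e2 addr0 e1_e2 !opN e2e2 !op0 !oppr0.
Qed.

(** * Moving operators past powers of x and y *)

Fact e1_xn n v : e1 (iter n x v) = iter n x (e1 v) - n%:R *: iter n.-1 x (xi v).
Proof.
rewrite (derive_iter (h := xi) (s := -1)) ?mulN1r ?scaleNr // => u.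
  by rewrite scaleN1r e1_x.
by rewrite xi_x.
Qed.

Fact e2_xn n v : e2 (iter n x v) = iter n x (e2 v) + n%:R *: iter n.-1 x (eta v).
Proof.
rewrite (derive_iter (h := eta) (s := 1)) ?mul1r // => u.
  by rewrite scale1r e2_x.
by rewrite eta_x.
Qed.

Fact f1_yn n v : f1 (iter n y v) = iter n y (f1 v) - n%:R *: iter n.-1 y (eta v).
Proof.
rewrite (derive_iter (h := eta) (s := -1)) ?mulN1r ?scaleNr // => u.
  by rewrite scaleN1r f1_y.
by rewrite eta_y.
Qed.

Fact f2_yn n v : f2 (iter n y v) = iter n y (f2 v) + n%:R *: iter n.-1 y (xi v).
Proof.
rewrite (derive_iter (h := xi) (s := 1)) ?mul1r // => u.
  by rewrite scale1r f2_y.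
by rewrite xi_y.
Qed.

Fact e1_yn n v : e1 (iter n y v) = iter n y (e1 v).
Proof. exact/commute_iter/e1_y. Qed.
Fact e2_yn n v : e2 (iter n y v) = iter n y (e2 v).
Proof. exact/commute_iter/e2_y. Qed.
Fact f1_xn n v : f1 (iter n x v) = iter n x (f1 v).
Proof. exact/commute_iter/f1_x. Qed.
Fact f2_xn n v : f2 (iter n x v) = iter n x (f2 v).
Proof. exact/commute_iter/f2_x. Qed.
Fact xi_yn n v : xi (iter n y v) = iter n y (xi v).
Proof. exact/commute_iter/xi_y. Qed.
Fact eta_yn n v : eta (iter n y v) = iter n y (eta v).
Proof. exact/commute_iter/eta_y. Qed.
Fact tx_yn n v : tx (iter n y v) = iter n y (tx v).
Proof. exact/commute_iter/tx_y. Qed.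
Fact y_xn n v : y (iter n x v) = iter n x (y v).
Proof. exact/commute_iter/y_x. Qed.

Fact xn_yn m n v : iter m x (iter n y v) = iter n y (iter m x v).
Proof. by elim: n => //= n IHn; rewrite -y_xn IHn. Qed.

Fact txn_yn m n v : iter m tx (iter n y v) = iter n y (iter m tx v).
Proof. by elim: m => //= m ->; rewrite tx_yn. Qed.

Fact iter0_op n i j : iter n (op i j) 0 = 0. Proof. exact: linear0. Qed.
Fact iterN_op n i j u : iter n (op i j) (- u) = - iter n (op i j) u.
Proof. exact: linearN. Qed.
Fact iterD_op n i j u v :
  iter n (op i j) (u + v) = iter n (op i j) u + iter n (op i j) v.
Proof. exact: linearD. Qed.
Fact iterZ_op n i j c u : iter n (op i j) (c *: u) = c *: iter n (op i j) u.
Proof. exact: linearZ. Qed.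

Let H : {linear M -> M} := (op pos2 pos2 \- op pos1 pos1)%R.
Let TX v : tx (x v) = x (tx v) + H v.
Proof. by rewrite tx_x. Qed.
Let HX v : H (x v) = x (H v) - 2 *: x v.
Proof.
rewrite /H /= !op_diag /= opD opN; rewrite !sub0r !subr0 scaleN1r scale1r.
by rewrite opprD addrACA -opprD -mulr2n scaler_nat.
Qed.
Let HT v : H (tx v) = tx (H v) + 2 *: tx v.
Proof.
rewrite /H /= !op_diag /= opD opN; rewrite !sub0r !subr0 scaleN1r scale1r.
by rewrite opprD opprK addrACA -mulr2n scaler_nat.
Qed.

(** The powers of [y] commute with [tx] and [x], so [raise_lower_top] applies
    below them. *)
Lemma raise_top k m j c u :
    has_weight c u -> c pos2 - c pos1 = m.*2%:R -> iter k.+1 tx u = 0 ->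
  iter (m + k) tx (iter m x (iter j y u)) =
    (ladder (m + k) (m + k).*2%:R / ladder k (m + k).*2%:R : K)
       *: iter j y (iter k tx u).
Proof.
move=> cu Hm Tu; rewrite xn_yn txn_yn (raise_lower_top TX HX HT) ?iterZ_op //.
by rewrite /H /= !cu -scalerBl Hm.
Qed.

Lemma raise_vanish k m j c u : has_weight c u -> iter k tx u = 0 ->
  iter (m + k) tx (iter m x (iter j y u)) = 0.
Proof.
move=> cu Tu; have Hu : H u = (c pos2 - c pos1) *: u by rewrite /H /= !cu scalerBl.
by rewrite xn_yn txn_yn (raise_lower_nilp TX HX HT _ Hu Tu) iter0_op.
Qed.

(** * Highest weight vectors of hook weight *)

Record hook_vector (a b : nat) (w : M) : Prop := HookVector {
  hook_has_weight : has_weight (nth 0 [:: - a%:R; a%:R; - b%:R; b%:R]) w;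
  hook_e1 : e1 w = 0; hook_e2 : e2 w = 0;
  hook_tx : tx w = 0; hook_ty : ty w = 0; hook_sg : sg w = 0; hook_ta : ta w = 0 }.

Section HookVector.
Variables (a b : nat) (w : M).
Hypothesis hw : hook_vector a b w.
Let d : K := (a + b)%:R.
Let e1w := hook_e1 hw.
Let e2w := hook_e2 hw.
Let txw := hook_tx hw.
Let tyw := hook_ty hw.
Let sgw := hook_sg hw.
Let taw := hook_ta hw.

Fact e1_f1w : e1 (f1 w) = d *: w.
Proof. by rewrite e1_f1 e1w op0 oppr0 add0r !(hook_has_weight hw) /= -scalerDl -natrD. Qed.
Fact e2_f2w : e2 (f2 w) = - d *: w.
Proof.
rewrite e2_f2 e2w op0 oppr0 add0r !(hook_has_weight hw) /= -scalerDl.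
by rewrite /d natrD opprD addrC.
Qed.
Fact e1_f2w : e1 (f2 w) = 0. Proof. by rewrite e1_f2 e1w op0 oppr0. Qed.
Fact e2_f1w : e2 (f1 w) = 0. Proof. by rewrite e2_f1 e2w op0 oppr0. Qed.
Fact e1_f1f2w : e1 (f1 (f2 w)) = d *: f2 w.
Proof.
rewrite e1_f1 e1_f2w op0 oppr0 add0r.
rewrite !(op_weight _ _ (hook_has_weight hw)) /= -scalerDl /d natrD; congr (_ *: _); ring.
Qed.
Fact e2_f1f2w : e2 (f1 (f2 w)) = d *: f1 w.
Proof. by rewrite e2_f1 e2_f2w opZ scaleNr opprK. Qed.
Fact tx_f1w : tx (f1 w) = 0. Proof. by rewrite tx_f1 txw sgw op0 subr0. Qed.
Fact tx_f2w : tx (f2 w) = 0. Proof. by rewrite tx_f2 txw taw op0 addr0. Qed.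
Fact ty_f1w : ty (f1 w) = 0. Proof. by rewrite ty_f1 tyw op0. Qed.
Fact ty_f2w : ty (f2 w) = 0. Proof. by rewrite ty_f2 tyw op0. Qed.
Fact sg_f1w : sg (f1 w) = 0. Proof. by rewrite sg_f1 sgw op0 oppr0. Qed.
Fact sg_f2w : sg (f2 w) = 0. Proof. by rewrite sg_f2 sgw tyw op0 oppr0 addr0. Qed.
Fact ta_f1w : ta (f1 w) = 0. Proof. by rewrite ta_f1 taw tyw op0 oppr0 addr0. Qed.
Fact ta_f2w : ta (f2 w) = 0. Proof. by rewrite ta_f2 taw op0 oppr0. Qed.
Fact ty_f1f2w : ty (f1 (f2 w)) = 0. Proof. by rewrite ty_f1 ty_f2w op0. Qed.
Fact sg_f1f2w : sg (f1 (f2 w)) = 0. Proof. by rewrite sg_f1 sg_f2w op0 oppr0. Qed.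
Fact ta_f1f2w : ta (f1 (f2 w)) = 0.
Proof. by rewrite ta_f1 ta_f2w ty_f2w op0 oppr0 addr0. Qed.
Fact tx_f1f2w : tx (f1 (f2 w)) = 0.
Proof. by rewrite tx_f1 tx_f2w sg_f2w op0 subr0. Qed.

Fact tx_xieta : tx (xi (eta w)) = y w.
Proof. by rewrite tx_xi tx_eta txw e2w e1_eta e1w !op0 subr0 op0 oppr0 !add0r. Qed.
Fact tx_xif1 : tx (xi (f1 w)) = d *: w.
Proof. by rewrite tx_xi tx_f1w e1_f1w op0 add0r. Qed.
Fact tx_etaf2 : tx (eta (f2 w)) = d *: w.
Proof. by rewrite tx_eta tx_f2w e2_f2w op0 add0r scaleNr opprK. Qed.
Fact tx_xietaf1f2 :
  tx (xi (eta (f1 (f2 w)))) = y (f1 (f2 w)) - d *: (eta (f2 w) + xi (f1 w)).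
Proof.
rewrite tx_xi tx_eta tx_f1f2w e2_f1f2w e1_eta e1_f1f2w op0 sub0r !opN !opZ.
by rewrite addrA addrC scalerDr -opprD [d *: xi _ + _]addrC.
Qed.
Fact tx2_xietaf1f2 : tx (tx (xi (eta (f1 (f2 w))))) = (- 2 * d ^+ 2) *: w.
Proof.
rewrite tx_xietaf1f2 opD opN opZ opD tx_y tx_f1f2w tx_xif1 tx_etaf2 op0 add0r.
by rewrite -scalerDl scalerA -scaleNr; congr (_ *: _); ring.
Qed.

Definition zero_vec := iter a x (iter b y w).

Lemma zero_vec_weight : has_weight (fun=> 0) zero_vec.
Proof.
move=> i; rewrite (iter_op_weight _ _ _ (iter_op_weight _ _ _ (hook_has_weight hw))).
by congr (_ *: _); elim/ord4_cases: i => /=; ring.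
Qed.

End HookVector.

Lemma iter_y_neq0 a b w : hook_vector a b w -> w != 0 -> iter b y w != 0.
Proof.
move=> hw; apply: contra_neq => ybw.
pose H' : {linear M -> M} := (op pos4 pos4 \- op pos3 pos3)%R.
have TY v : ty (y v) = y (ty v) + H' v by rewrite ty_y.
have HY v : H' (y v) = y (H' v) - 2 *: y v.
  rewrite /H' /= !op_diag /= opD opN !sub0r !subr0 scaleN1r scale1r.
  by rewrite opprD addrACA -opprD -mulr2n scaler_nat.
have Hw : H' w = b.*2%:R *: w.
  by rewrite /H' /= !(hook_has_weight hw) -scalerBl /= opprK -natrD addnn.
have := raise_lower TY HY b Hw (hook_ty hw); rewrite ybw iter0_op => /esym/eqP.
by rewrite scaler_eq0 (negPf (ladder_neq0 _ _)) -?addnn ?leq_addr // => /eqP.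
Qed.

(** * The typical case *)

Section TypicalHook.
Variables (n b : nat) (w : M).
Hypothesis hw : hook_vector n.+1 b w.
Let d : K := (n.+1 + b)%:R.

Fact natr_pred_iter (m : nat) (k l : 'I_4) (v : M) :
  m%:R *: iter m.-1 (op k l) (op k l v) = m%:R *: iter m (op k l) v.
Proof. by case: m => [|m]; rewrite ?scale0r // -iterSr. Qed.

Let xixi v : xi (xi v) = 0. Proof. exact: odd_square. Qed.
Let etaeta v : eta (eta v) = 0. Proof. exact: odd_square. Qed.

Lemma e1e2_zero_vec : e1 (e2 (zero_vec n.+1 b w)) =
  n.+1%:R *: (iter n x (iter b.+1 y w) - n%:R *: iter n.-1 x (iter b y (xi (eta w)))).
Proof.
rewrite /zero_vec e2_xn e2_yn (hook_e2 hw) !iter0_op add0r eta_yn opZ.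
by rewrite e1_xn e1_yn e1_eta (hook_e1 hw) op0 oppr0 add0r xi_yn -iterSr.
Qed.

Fact f2_xieta v : f2 (xi (eta v)) = xi (eta (f2 v)) - x (xi v).
Proof. by rewrite f2_xi f2_eta opD opN opprD opprK xi_x. Qed.

Fact f1_xieta v : f1 (xi (eta v)) = xi (eta (f1 v)) + x (eta v).
Proof. by rewrite f1_xi f1_eta opN opprK. Qed.

Fact iter_xy_x i j v : iter i x (iter j y (x v)) = iter i.+1 x (iter j y v).
Proof. by rewrite xn_yn -iterSr -xn_yn. Qed.

Lemma f2e1e2_zero_vec : f2 (e1 (e2 (zero_vec n.+1 b w))) =
  n.+1%:R *: (iter n x (iter b.+1 y (f2 w)) + d *: iter n x (iter b y (xi w))
     - n%:R *: iter n.-1 x (iter b y (xi (eta (f2 w))))).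
Proof.
rewrite e1e2_zero_vec opZ opD opN opZ !f2_xn !f2_yn xixi f2_xieta.
rewrite !iter0_op scaler0 addr0 !iterD_op !iterN_op iter_xy_x iterZ_op.
have nn v : n%:R *: iter n.-1.+1 x v = n%:R *: iter n x v.
  by case: n => [|m]; rewrite ?scale0r.
rewrite [n%:R *: (_ - _)]scalerBr nn opprB; congr (_ *: _).
rewrite addrA /=; congr (_ - _); rewrite -addrA -scalerDl -natrD; congr (_ + _).
by rewrite /d addSnnS addnC.
Qed.

(** Of the six monomials in the expansion of the invariant vector, raising
    [n.+1] times kills [x^n y^(b+1) f1 f2 w] and sends the others to multiples of
    [y^b w].  The sum of their coefficients factors, and for [a = n.+1] the factor
    [n%:R - b%:R] is [a - b - 1]. *)
Lemma raise_typical :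
  iter n.+1 tx (f1 (f2 (e1 (e2 (zero_vec n.+1 b w))))) =
    (n.+1%:R * d * (n%:R - b%:R) / (2 * n.*2.+1%:R) * ladder n.+1 n.+1.*2%:R)
      *: iter b y w.
Proof.
have wt := hook_has_weight hw.
set C := ladder _ _.
set L := iter n.+1 tx.
have A1 : L (iter n.+1 x (iter b y w)) = C *: iter b y w.
  rewrite /L; have := @raise_top 0 n.+1 b _ _ wt; rewrite addn0 => ->.
  - by rewrite /ladder big_ord0 divr1.
  - by rewrite /= opprK -natrD addnn.
  - exact: hook_tx hw.
have L1 c u j : has_weight c u -> c pos2 - c pos1 = n.*2%:R -> tx (tx u) = 0 ->
    L (iter n x (iter j y u)) = (C / n.+1.*2%:R) *: iter j y (tx u).
  move=> cu Hc Tu; have := @raise_top 1 n j _ _ cu Hc Tu.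
  by rewrite addn1 ladder1.
have A2 : b%:R *: L (iter n x (iter b.-1 y (xi (eta w)))) = (C / n.+1.*2%:R * b%:R) *: iter b y w.
  rewrite (L1 _ _ _ (op_weight _ _ (op_weight _ _ wt))) /=.
  - by rewrite (tx_xieta hw) scalerA [b%:R * _]mulrC -!scalerA natr_pred_iter.
  - by rewrite -mul2n natrM mulrSr; ring.
  - by rewrite (tx_xieta hw) tx_y (hook_tx hw) op0.
have A3 : L (iter n x (iter b y (xi (f1 w)))) = (C / n.+1.*2%:R * d) *: iter b y w.
  rewrite (L1 _ _ _ (op_weight _ _ (op_weight _ _ wt))) /=.
  - by rewrite (tx_xif1 hw) iterZ_op scalerA.
  - by rewrite -mul2n natrM mulrSr; ring.
  - by rewrite (tx_xif1 hw) opZ (hook_tx hw) scaler0.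
have A4 : L (iter n x (iter b y (eta (f2 w)))) = (C / n.+1.*2%:R * d) *: iter b y w.
  rewrite (L1 _ _ _ (op_weight _ _ (op_weight _ _ wt))) /=.
  - by rewrite (tx_etaf2 hw) iterZ_op scalerA.
  - by rewrite -mul2n natrM mulrSr; ring.
  - by rewrite (tx_etaf2 hw) opZ (hook_tx hw) scaler0.
have A5 : L (iter n x (iter b.+1 y (f1 (f2 w)))) = 0.
  rewrite /L -addn1 (raise_vanish _ _ (op_weight _ _ (op_weight _ _ wt))) //=.
  exact: tx_f1f2w hw.
(* Raising [xi eta f1 f2 w] by [tx] reaches a multiple of [w] only in the second
   step, whence the quadratic denominator. *)
have A6 : n%:R *: L (iter n.-1 x (iter b y (xi (eta (f1 (f2 w)))))) =
    (n%:R * (C / (n.+1.*2%:R * (2 * (n.+1.*2%:R - 1)))) * (- 2 * d ^+ 2)) *: iter b y w.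
  rewrite /L /C; case: n hw wt @d => [|m] hw' wt' d'; first by rewrite !mul0r !scale0r.
  have wt6 := op_weight pos1 pos4 (op_weight pos3 pos2
    (op_weight pos4 pos2 (op_weight pos1 pos3 wt'))).
  have := raise_top (k := 2) (m := m) b wt6; rewrite addn2 ladder2 /= => ->.
  - by rewrite (tx2_xietaf1f2 hw') iterZ_op !scalerA.
  - by rewrite -mul2n natrM; ring.
  - by rewrite (tx2_xietaf1f2 hw') opZ (hook_tx hw') scaler0.
have nn v : n%:R *: iter n.-1.+1 x v = n%:R *: iter n x v.
  by case: (n) => [|m]; rewrite ?scale0r.
rewrite /L f2e1e2_zero_vec opZ !opD opN !opZ !f1_xn !f1_yn f1_xieta f1_xi.
rewrite [eta (xi (eta _))]eta_xi etaeta op0 oppr0 iter0_op scaler0 subr0 eta_xi.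
rewrite iterN_op scalerN opprK.
rewrite !iterD_op !iterN_op !iter_xy_x [n%:R *: (_ + _)]scalerDr nn.
rewrite [b.+1.-1]/= !(iterZ_op, iterD_op, iterN_op) -/L.
rewrite A1 A2 A3 A4 A5 A6 sub0r !(scalerA, =^~scaleNr, =^~scalerDl); congr (_ *: _).
rewrite {}/d natrD -!muln2 -!natr1 !natrM -!natr1; field.
by rewrite -natrM !natr1 !pnatr_eq0.
Qed.

Lemma typical_neq0 : n != b -> iter b y w != 0 -> f1 (f2 (e1 (e2 (zero_vec n.+1 b w)))) != 0.
Proof.
move=> nb ybw; apply/eqP => om0; have := raise_typical; rewrite om0 iter0_op => /esym/eqP.
rewrite scaler_eq0 (negPf ybw) orbF !mulf_eq0 !invr_eq0 !mulf_eq0 !pnatr_eq0 subr_eq0 eqr_nat.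
by rewrite (negPf nb) (negPf (ladder_neq0 _ _)) // -addnn leq_addr.
Qed.

End TypicalHook.

(** * The atypical case *)

(** The identity of the block {2, 4} induces the grading of [g] with degree zero
    part [k]. *)
Definition degree (c : K) v := op pos2 pos2 v + op pos4 pos4 v = c *: v.

Record singular (c : K) v : Prop := Singular {
  sing_degree : degree c v;
  sing_tx : tx v = 0; sing_ty : ty v = 0; sing_sg : sg v = 0; sing_ta : ta v = 0 }.

Section AtypicalHook.
Variables (b : nat) (w : M).
Hypothesis hw : hook_vector b.+1 b w.
Let d : K := (b.+1 + b)%:R.

Let f1f1 v : f1 (f1 v) = 0. Proof. exact: odd_square. Qed.
Let f2f2 v : f2 (f2 v) = 0. Proof. exact: odd_square. Qed.

Let wt := hook_has_weight hw.
Let e1w := hook_e1 hw.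
Let e2w := hook_e2 hw.
Let txw := hook_tx hw.
Let tyw := hook_ty hw.
Let sgw := hook_sg hw.
Let taw := hook_ta hw.

Lemma degree_weight c u : has_weight c u -> c pos2 + c pos4 = d - 1 -> degree (d - 1) u.
Proof. by move=> cu dc; rewrite /degree !cu -scalerDl dc. Qed.

Let degreeD u v : degree (d - 1) u -> degree (d - 1) v -> degree (d - 1) (u + v).
Proof. by rewrite /degree => du dv; rewrite !opD addrACA du dv scalerDr. Qed.
Let degreeZ k u : degree (d - 1) u -> degree (d - 1) (k *: u).
Proof. by rewrite /degree => du; rewrite !opZ -scalerDr du !scalerA mulrC. Qed.
Let degreeN u : degree (d - 1) u -> degree (d - 1) (- u).
Proof. by rewrite -scaleN1r; apply: degreeZ. Qed.

Let wt_f1w := op_weight pos4 pos2 wt.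
Let wt_f2w := op_weight pos1 pos3 wt.
Let wt_f1f2w := op_weight pos4 pos2 wt_f2w.

Local Ltac deg := rewrite /= /d ?natrD -!natr1; ring.
Local Ltac cancel_on v :=
  rewrite ?(scalerN, scalerA, =^~scaleNr, =^~scalerDl) -[RHS](scale0r v);
  congr (_ *: _); deg.

(** The four vectors below are singular only because [a = b + 1]: the scalars
    coming from the Cartan subalgebra then cancel. *)
Lemma singular_xi : singular (d - 1) (d *: xi w + y (f2 w)).
Proof.
split.
- apply: degreeD; first apply: degreeZ.
    by apply: (degree_weight (op_weight _ _ wt)); deg.
  by apply: (degree_weight (op_weight _ _ wt_f2w)); deg.
- by rewrite opD opZ tx_xi tx_y txw e1w (tx_f2w hw)
    !(op0, oppr0, addr0, subr0, scaler0).
- rewrite opD opZ ty_xi ty_y tyw (ty_f2w hw) !op0 sub0r add0r !wt_f2w.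
  cancel_on (f2 w).
- rewrite opD opZ sg_xi sg_y sgw (sg_f2w hw) !op0 oppr0 !add0r !wt (e2_f2w hw).
  cancel_on w.
- by rewrite opD opZ ta_xi ta_y taw (ta_f2w hw) (e1_f2w hw)
    !(op0, oppr0, addr0, subr0, scaler0).
Qed.

Lemma singular_eta : singular (d - 1) (d *: eta w - y (f1 w)).
Proof.
split.
- apply: degreeD; [apply: degreeZ | apply: degreeN].
    by apply: (degree_weight (op_weight _ _ wt)); deg.
  by apply: (degree_weight (op_weight _ _ wt_f1w)); deg.
- by rewrite opD opN opZ tx_eta tx_y txw e2w (tx_f1w hw)
    !(op0, oppr0, addr0, subr0, scaler0).
- rewrite opD opN opZ ty_eta ty_y tyw (ty_f1w hw) !op0 !add0r !wt_f1w.
  cancel_on (f1 w).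
- by rewrite opD opN opZ sg_eta sg_y sgw (sg_f1w hw) (e2_f1w hw)
    !(op0, oppr0, addr0, subr0, scaler0).
- rewrite opD opN opZ ta_eta ta_y taw (ta_f1w hw) (e1_f1w hw) !op0 oppr0 !add0r !wt.
  cancel_on w.
Qed.

Lemma singular_xif1f2 : singular (d - 1) (xi (f1 (f2 w)) - x (f2 w)).
Proof.
split.
- apply: degreeD; last apply: degreeN.
    by apply: (degree_weight (op_weight _ _ wt_f1f2w)); deg.
  by apply: (degree_weight (op_weight _ _ wt_f2w)); deg.
- rewrite opD opN tx_xi tx_x (tx_f1f2w hw) (tx_f2w hw) (e1_f1f2w hw) !op0 !add0r !wt_f2w.
  cancel_on (f2 w).
- by rewrite opD opN ty_xi ty_x (ty_f1f2w hw) (ty_f2w hw) f2_f1 f2f2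
    !(op0, oppr0, addr0, subr0, scaler0).
- rewrite opD opN sg_xi sg_x (sg_f1f2w hw) (sg_f2w hw) !op0 oppr0 !add0r !wt_f1f2w.
  rewrite -[- f1 (f2 w)]scaleN1r; cancel_on (f1 (f2 w)).
- by rewrite opD opN ta_xi ta_x (ta_f1f2w hw) (ta_f2w hw) f2f2
    !(op0, oppr0, addr0, subr0, scaler0).
Qed.

Lemma singular_etaf1f2 : singular (d - 1) (eta (f1 (f2 w)) + x (f1 w)).
Proof.
split.
- apply: degreeD.
    by apply: (degree_weight (op_weight _ _ wt_f1f2w)); deg.
  by apply: (degree_weight (op_weight _ _ wt_f1w)); deg.
- rewrite opD tx_eta tx_x (tx_f1f2w hw) (tx_f1w hw) (e2_f1f2w hw) !op0 sub0r add0r !wt_f1w.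
  cancel_on (f1 w).
- by rewrite opD ty_eta ty_x (ty_f1f2w hw) (ty_f1w hw) f1f1
    !(op0, oppr0, addr0, subr0, scaler0).
- by rewrite opD sg_eta sg_x (sg_f1f2w hw) (sg_f1w hw) f1f1
    !(op0, oppr0, addr0, subr0, scaler0).
- rewrite opD ta_eta ta_x (ta_f1f2w hw) (ta_f1w hw) f2_f1 !op0 oppr0 !add0r opprK !wt_f1f2w.
  rewrite -[f1 (f2 w) in X in _ + X]scale1r; cancel_on (f1 (f2 w)).
Qed.

Hypothesis no_singular : forall v, singular (d - 1) v -> v = 0.

(** Each of e1, e2, f1 and f2 maps the two terms to the same vector up to a scalar,
    and the ratio of the two scalars is the same for all four. *)
Definition atypical_vec : M :=
  d *: zero_vec b.+1 b w - iter b x (iter b.+1 y (f1 (f2 w))).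

Let d_xi : d *: xi w = - y (f2 w).
Proof. by apply/eqP; rewrite -addr_eq0; apply/eqP/no_singular/singular_xi. Qed.
Let d_eta : d *: eta w = y (f1 w).
Proof. exact/subr0_eq/no_singular/singular_eta. Qed.
Let xi_f1f2 : xi (f1 (f2 w)) = x (f2 w).
Proof. exact/subr0_eq/no_singular/singular_xif1f2. Qed.
Let eta_f1f2 : eta (f1 (f2 w)) = - x (f1 w).
Proof. by apply/eqP; rewrite -addr_eq0; apply/eqP/no_singular/singular_etaf1f2. Qed.

Let pred_iter v : b%:R *: iter b.-1.+1 x v = b%:R *: iter b x v.
Proof. by case: (b) => [|m]; rewrite ?scale0r. Qed.

Let pred_iter_y i v :
  b%:R *: iter i x (iter b.-1.+1 y v) = b%:R *: iter i x (iter b y v).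
Proof. by case: (b) => [|m]; rewrite ?scale0r. Qed.

Let d_iter_xi i j : d *: iter i x (iter j y (xi w)) = - iter i x (iter j.+1 y (f2 w)).
Proof. by rewrite -!iterZ_op d_xi !iterN_op -iterSr. Qed.
Let d_iter_eta i j : d *: iter i x (iter j y (eta w)) = iter i x (iter j.+1 y (f1 w)).
Proof. by rewrite -!iterZ_op d_eta -iterSr. Qed.

Lemma e1_atypical : e1 atypical_vec = 0.
Proof.
rewrite opD opN opZ !e1_xn !e1_yn e1w (e1_f1f2w hw) !xi_yn xi_f1f2 iter_xy_x pred_iter.
rewrite !iter0_op sub0r !iterZ_op scalerN scalerA mulrC -scalerA d_iter_xi.
cancel_on (iter b x (iter b.+1 y (f2 w))).
Qed.

Lemma e2_atypical : e2 atypical_vec = 0.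
Proof.
rewrite opD opN opZ !e2_xn !e2_yn e2w (e2_f1f2w hw) !eta_yn eta_f1f2.
rewrite !iterN_op iter_xy_x scalerN pred_iter.
rewrite !iter0_op add0r !iterZ_op scalerA mulrC -scalerA d_iter_eta.
cancel_on (iter b x (iter b.+1 y (f1 w))).
Qed.

Lemma f1_atypical : f1 atypical_vec = 0.
Proof.
rewrite opD opN opZ !f1_xn !f1_yn f1f1 eta_f1f2 !iterN_op iter0_op scalerN sub0r opprK.
rewrite !(iterD_op, iterN_op, iterZ_op, iter_xy_x) scalerBr.
rewrite [d *: (b%:R *: _)]scalerA mulrC -scalerA d_iter_eta.
rewrite ?scalerN pred_iter_y /=.
cancel_on (iter b.+1 x (iter b y (f1 w))).
Qed.

Lemma f2_atypical : f2 atypical_vec = 0.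
Proof.
rewrite opD opN opZ !f2_xn !f2_yn f2_f1 f2f2 xi_f1f2 op0.
rewrite !(iterD_op, iterN_op, iterZ_op, iter_xy_x) scalerDr !(iter0_op, oppr0, add0r).
rewrite [d *: (b%:R *: _)]scalerA mulrC -scalerA d_iter_xi.
rewrite ?scalerN pred_iter_y /=.
cancel_on (iter b.+1 x (iter b y (f2 w))).
Qed.

Lemma atypical_invariant i j : in_k i j -> op i j atypical_vec = 0.
Proof.
have dv k : op k k atypical_vec = 0.
  rewrite opD opN opZ (zero_vec_weight hw) scale0r scaler0 sub0r.
  rewrite (iter_op_weight _ _ _ (iter_op_weight _ _ _ wt_f1f2w)).
  apply/eqP; rewrite oppr_eq0 scaler_eq0; apply/orP; left; apply/eqP.
  by elim/ord4_cases: k => /=; ring.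
elim/ord4_cases: i; elim/ord4_cases: j => // _.
- exact: f2_atypical.
- exact: e1_atypical.
- exact: e2_atypical.
- exact: f1_atypical.
Qed.

(** Raising [b.+1] times with [tx] kills the second term, since [f1 f2 w] has sl2
    weight only [2b], but not the first. *)
Lemma atypical_neq0 : w != 0 -> atypical_vec != 0.
Proof.
move=> w0; have yw := iter_y_neq0 hw w0; apply: contraNneq yw => /(congr1 (iter b.+1 tx)).
rewrite iter0_op iterD_op iterN_op iterZ_op.
rewrite -{3}addn1 (raise_vanish _ _ wt_f1f2w) ?(tx_f1f2w hw) // subr0.
have /= := raise_top (k := 0) (m := b.+1) b wt; rewrite addn0 => ->; last 2 first.
- by rewrite /= opprK -natrD addnn.
- exact: txw.
rewrite ladder0 divr1 => /eqP; rewrite !scaler_eq0 pnatr_eq0 orFb.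
by rewrite (negPf (ladder_neq0 _ _)) // -addnn leq_addr.
Qed.

End AtypicalHook.
End Gl22Operators.

(** * Vanishing of singular vectors in irreducible modules *)

Section Gl22Module.
Variables (R : realType) (V : gl22_module R).
Local Notation C := R[i].
Local Notation M := (carrier V).

HB.instance Definition _ (X : 'M[C]_4) :=
  GRing.isLinear.Build C M M *:%R (act X) (act_linear_r X).

Definition unit_act (i j : 'I_4) : {linear M -> M} := act (E R i j).

Lemma homogeneous_E i j : homogeneous (parity i (+) parity j) (E R i j).
Proof.
move=> k l; rewrite mxE; case: (k =P i) => [->|//]; case: (l =P j) => [->|//].
by rewrite eqxx.
Qed.

(** The action with its arguments exchanged, to carry linearity in the matrix. *)
Definition actl (v : M) (X : 'M[C]_4) : M := act X v.
HB.instance Definition _ (v : M) :=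
  GRing.isLinear.Build C 'M[C]_4 M *:%R (actl v) (act_linear_l v).

Lemma unit_act_relations : gl22_relations unit_act.
Proof.
move=> i j k l v /=.
have := act_bracket v (@homogeneous_E i j) (@homogeneous_E k l).
rewrite /sbracket /E !mul_delta_mx_cond -[delta_mx i l *+ _]scaler_nat.
rewrite -[delta_mx k j *+ _]scaler_nat -/(actl v _).
rewrite linearB !linearZ /= /actl scalerA => /eqP.
by rewrite !scalerN eq_sym subr_eq addrC => /eqP ->.
Qed.

Lemma act_unit (X : 'M[C]_4) (v : M) : act X v = \sum_i \sum_j X i j *: unit_act i j v.
Proof.
rewrite {1}[X]matrix_sum_delta -/(actl v _) linear_sum; apply: eq_bigr => i _.
by rewrite linear_sum; apply: eq_bigr => j _; rewrite linearZ.
Qed.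

Definition even_proj (v : M) : M := (v.1, 0).

Fact even_proj_is_linear : linear even_proj.
Proof. by move=> c u v; congr (_, _); rewrite /= scaler0 addr0. Qed.
HB.instance Definition _ :=
  GRing.isLinear.Build C M M *:%R even_proj even_proj_is_linear.

Lemma unit_act_even_proj i j v : unit_act i j (even_proj v) =
  if parity i (+) parity j then unit_act i j v - even_proj (unit_act i j v)
  else even_proj (unit_act i j v).
Proof.
have Dv : v = even_proj v + (0, v.2).
  by rewrite [LHS]surjective_pairing; congr (_, _) => /=; rewrite ?addr0 ?add0r.
have opv : unit_act i j v = unit_act i j (even_proj v) + unit_act i j (0, v.2).
  by rewrite -linearD -Dv.
have hom := @homogeneous_E i j; rewrite opv.
have epD u t : even_proj (u + t) = even_proj u + even_proj t by exact: linearD.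
rewrite epD.
case: ifP hom => _ hom.
  have [a0 a1] := act_odd V hom.
  have -> : even_proj (unit_act i j (even_proj v)) = 0 by congr (_, _); apply: a0.
  have -> : even_proj (unit_act i j (0, v.2)) = unit_act i j (0, v.2).
    by rewrite [RHS]surjective_pairing; congr (_, _); rewrite a1.
  by rewrite add0r addrK.
have [a0 a1] := act_even V hom.
have -> : even_proj (unit_act i j (0, v.2)) = 0 by congr (_, _); apply: a1.
by rewrite addr0 [LHS]surjective_pairing; congr (_, _); apply: a0.
Qed.

Section Singular.
(* The grading that gives [E i j] the degree [g i - g j]. *)
Variable g : 'I_4 -> nat.

Definition grade (v : M) : M := \sum_i (g i)%:R *: unit_act i i v.

Fact grade_is_linear : linear grade.
Proof.
move=> c u v; rewrite /grade scaler_sumr -big_split; apply: eq_bigr => i _ /=.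
by rewrite linearP scalerDr !scalerA mulrC.
Qed.
HB.instance Definition _ := GRing.isLinear.Build C M M *:%R grade grade_is_linear.

Lemma grade_unit_act k l v :
  grade (unit_act k l v) = unit_act k l (grade v) + ((g k)%:R - (g l)%:R) *: unit_act k l v.
Proof.
rewrite /grade linear_sum.
under eq_bigr do rewrite (op_diag unit_act_relations) scalerDr scalerA mulrBr.
rewrite big_split -scaler_suml sumrB.
have sum_delta m : \sum_i (g i)%:R * (i == m)%:R = (g m)%:R :> C.
  rewrite (bigD1 m) //= eqxx mulr1 big1 ?addr0 // => i /negPf ->.
  by rewrite mulr0.
rewrite !sum_delta; congr (_ + _); apply: eq_bigr => i _.
by rewrite linearZ.
Qed.

Definition grade_singular (c : C) (v : M) :=
  grade v = c *: v /\ forall i j, (g j < g i)%N -> unit_act i j v = 0.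

Variable c : C.

(** The submodule generated by all singular vectors of degree [c] at once, so that
    it is stable under the projection to the even part; only operators that do not
    raise the degree are applied to them. *)
Inductive singular_span : M -> Prop :=
| SpanSingular u of grade_singular c u : singular_span u
| SpanLinear k u v of singular_span u & singular_span v : singular_span (k *: u + v)
| SpanLower i j v of (g i <= g j)%N & singular_span v : singular_span (unit_act i j v).

Let span0 : singular_span 0.
Proof. by apply: SpanSingular; split=> *; rewrite linear0 ?scaler0. Qed.

Let spanZ k u : singular_span u -> singular_span (k *: u).
Proof. by move=> su; rewrite -[_ *: _]addr0; apply: SpanLinear. Qed.

Let spanD u v : singular_span u -> singular_span v -> singular_span (u + v).
Proof. by move=> su sv; rewrite -[u]scale1r; apply: SpanLinear. Qed.

Let spanN u : singular_span u -> singular_span (- u).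
Proof. by rewrite -scaleN1r; apply: spanZ. Qed.

(** A raising operator commuted down to a singular vector kills it, and the
    brackets met on the way are again matrix units, covered by the induction. *)
Lemma span_unit_act v i j : singular_span v -> singular_span (unit_act i j v).
Proof.
move=> sv; elim: sv i j => {v} [u su|k u v _ IHu _ IHv|k l v gkl sv IHv] i j.
- have [lij|lij] := ltnP (g j) (g i); first by rewrite (proj2 su).
  exact: SpanLower lij (SpanSingular su).
- by rewrite linearP; apply: SpanLinear.
have [lij|lij] := ltnP (g j) (g i); last exact: SpanLower lij (SpanLower gkl sv).
rewrite unit_act_relations; apply: spanD; first exact/spanZ/SpanLower.
by apply: spanD; [|apply: spanN]; apply: spanZ.
Qed.

Lemma span_even_proj v : singular_span v -> singular_span (even_proj v).
Proof.
elim=> {v} [u [hu su]|k u v _ IHu _ IHv|k l v gkl sv IHv].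
- apply: SpanSingular; split=> [|i j /su uij].
    have epZ k t : even_proj (k *: t) = k *: even_proj t by exact: linearZ.
    rewrite -epZ -hu; transitivity (\sum_i even_proj ((g i)%:R *: unit_act i i u)).
      by apply: eq_bigr => i _; rewrite epZ unit_act_even_proj addbb.
    by rewrite [RHS]linear_sum.
  have ep0 : even_proj 0 = 0 by exact: linear0.
  by rewrite unit_act_even_proj uij ep0 subr0 if_same.
- by rewrite linearP; apply: SpanLinear.
have := unit_act_even_proj k l v; case: ifP => _ => [/eqP|<-]; last exact: span_unit_act.
rewrite eq_sym subr_eq addrC -subr_eq => /eqP <-.
by apply: spanD; [|apply: spanN]; apply: span_unit_act.
Qed.

Lemma span_submodule : graded_submodule singular_span.
Proof.
split; [exact: span0|exact: SpanLinear|exact: span_even_proj|move=> X v sv].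
rewrite act_unit; elim/big_ind: _ => // i _; elim/big_ind: _ => // j _.
exact/spanZ/span_unit_act.
Qed.

(** A product of factors [grade - (c - n)], with [n] ranging over [s]. *)
Definition annihilate (s : seq nat) (v : M) :=
  foldr (fun n u => grade u - (c - n%:R) *: u) v s.

(** The grading has only the eigenvalues [c - n] on the span, because its
    generators have degree [c] and the applied operators lower the degree. *)
Lemma span_annihilated v : singular_span v -> exists s, annihilate s v = 0.
Proof.
have annihilateP s k u t : annihilate s (k *: u + t) = k *: annihilate s u + annihilate s t.
  elim: s => //= n s ->; rewrite linearP [in LHS]scalerDr opprD addrACA.
  by rewrite scalerBr !scalerA [k * _]mulrC.
have annihilate0 s : annihilate s 0 = 0 by elim: s => //= n s ->; rewrite linear0 scaler0 subr0.
have gradeB k u t : grade (u - k *: t) = grade u - k *: grade t.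
  by rewrite linearB linearZ.
have annihilateC s t u : annihilate s (annihilate t u) = annihilate t (annihilate s u).
  have grade_annihilate s' u' : annihilate s' (grade u') = grade (annihilate s' u').
    by elim: s' => //= n s' ->; rewrite gradeB.
  elim: s u => //= n s IHs u; rewrite IHs -grade_annihilate.
  by rewrite addrC [in RHS]addrC -!scaleNr annihilateP.
elim=> {v} [u [hu _]|k u v _ [s su] _ [t tv]|i j v gij _ [s sv]].
- by exists [:: 0%N]; rewrite /= hu subr0 subrr.
- exists (s ++ t); rewrite /annihilate foldr_cat -!/(annihilate _ _) annihilateP tv addr0.
  by rewrite -[k *: _]addr0 annihilateP annihilate0 addr0 annihilateC su annihilate0 scaler0.
exists [seq (n + (g j - g i))%N | n <- s].
suff -> : annihilate [seq (n + (g j - g i))%N | n <- s] (unit_act i j v) =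
    unit_act i j (annihilate s v).
  by rewrite sv linear0.
have opB k u t : unit_act i j (u - k *: t) = unit_act i j u - k *: unit_act i j t.
  by rewrite linearB linearZ.
elim: {sv} s => //= n s ->; rewrite opB grade_unit_act -addrA; congr (_ + _).
by rewrite -scalerBl -scaleNr natrD natrB //; congr (_ *: _); ring.
Qed.

(** The span of the singular vectors of degree [c] misses every nonzero vector of
    higher degree, hence is a proper submodule and vanishes. *)
Lemma no_singular (m : nat) (w v : M) : irreducible V -> w != 0 ->
  grade w = (c + m.+1%:R) *: w -> grade_singular c v -> v = 0.
Proof.
move=> [_ irr] w0 hw sv; case: (irr _ span_submodule) => [|all_span].
  by apply; apply: SpanSingular.
have [s sw] := span_annihilated (all_span w).
suff [k k0 kw] : exists2 k : C, k != 0 & annihilate s w = k *: w.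
  by move/eqP: sw; rewrite kw scaler_eq0 (negPf k0) (negPf w0).
elim: s {sw} => [|n s [k k0 /= ->]]; first by exists 1; rewrite ?oner_neq0 ?scale1r.
exists (k * (m.+1 + n)%:R); first by rewrite mulf_neq0 // pnatr_eq0.
have -> : grade (k *: w) = k *: grade w by exact: linearZ.
by rewrite hw !scalerA -scalerBl natrD; congr (_ *: _); ring.
Qed.

End Singular.

(** * Spherical vectors *)

Lemma borel_unit i j : i = j \/ positive (root_of R i j) -> borel (E R i j).
Proof.
move=> ij k l; rewrite mxE; case: (k =P i) => [->|_]; last by rewrite eqxx.
by case: (l =P j) => [->|_]; last rewrite eqxx.
Qed.

Lemma highest_weight_unit mu (w : M) i j : highest_weight_vector mu w ->
  i = j \/ positive (root_of R i j) -> unit_act i j w = (mu 0 i * (i == j)%:R) *: w.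
Proof.
move=> [_ hw] ij; rewrite /unit_act /= hw; last exact: borel_unit.
congr (_ *: _); rewrite (bigD1 i) //= big1 ?addr0 ?mxE ?eqxx //.
by move=> k /negPf ki; rewrite mxE ki mulr0.
Qed.

Lemma hook_vectorP (la : seq nat) (w : M) : highest_weight_vector (hook_weight R la) w ->
  hook_vector unit_act (nth 0%N la 0) (size la).-1 w.
Proof.
move=> hw; have hwE := highest_weight_unit hw.
have pos i j c1 c2 c3 :
    root_of R i j = (eps_minus R - delta_minus R) *+ c1 + (delta_minus R - delta_plus R) *+ c2
      + (delta_plus R - eps_plus R) *+ c3 -> i != j -> unit_act i j w = 0.
  move=> ij /negPf nij; rewrite hwE; last by right; exists c1, c2, c3.
  by rewrite nij mulr0 scale0r.
split.
- move=> i; rewrite hwE; last by left.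
  rewrite eqxx mulr1 /hook_weight /eps_minus /eps_plus /delta_minus /delta_plus.
  rewrite /coordinate; congr (_ *: _); elim/ord4_cases: i; rewrite !(mxE, mulmxnE) /=; ring.
- apply: (pos _ _ 1 0 0)%N => //; rewrite !mulr0n !addr0 //.
- apply: (pos _ _ 0 0 1)%N => //; rewrite !mulr0n !add0r //.
- apply: (pos _ _ 1 1 1)%N => //; rewrite !mulr1n !addrA !subrK //.
- apply: (pos _ _ 0 1 0)%N => //; rewrite !mulr0n !add0r ?addr0 //.
- apply: (pos _ _ 0 1 1)%N => //; rewrite !mulr0n !mulr1n !add0r !addrA !subrK //.
- apply: (pos _ _ 1 1 0)%N => //; rewrite !mulr0n !mulr1n !addr0 !addrA !subrK //.
Qed.

Lemma k_spherical_units (v : M) : v != 0 ->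
  (forall i j, in_k i j -> unit_act i j v = 0) -> k_spherical V.
Proof.
move=> v0 kv; exists v; split=> // X /coord_span ->.
rewrite -/(actl v _) linear_sum big1 // => i _; rewrite linearZ /= /actl.
suff /allP ks : all (fun Y => act Y v == 0) [:: E R pos1 pos1; E R pos2 pos2; E R pos3 pos3;
    E R pos4 pos4; E R pos1 pos3; E R pos3 pos1; E R pos2 pos4; E R pos4 pos2].
  by rewrite (eqP (ks _ (mem_nth _ _))) ?scaler0.
by rewrite /= -!/(unit_act _ _ v) !kv ?eqxx.
Qed.

(** With [w] of weight zero, [f1 w] and [f2 w] are singular for the grading by the
    height with respect to the order 2, 4, 3, 1, one step below [w]. *)
Lemma trivial_hook_invariant (w : M) i j : irreducible V -> w != 0 ->
  hook_vector unit_act 0 0 w -> in_k i j -> unit_act i j w = 0.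
Proof.
move=> irr w0 hw; pose g (k : 'I_4) := nth 0%N [:: 0; 3; 1; 2]%N k.
have rel := unit_act_relations.
have dw k : unit_act k k w = 0.
  rewrite (hook_has_weight hw) -[RHS](scale0r w); congr (_ *: _).
  by elim/ord4_cases: k => /=; rewrite ?oppr0.
have gw : grade g w = 0 by rewrite /grade big1 // => k _; rewrite dw scaler0.
have sing k l : (g l).+1%N = (g k) :> nat ->
    (forall k' l', (g l' < g k')%N -> unit_act k' l' (unit_act l k w) = 0) -> unit_act l k w = 0.
  move=> glk raise; apply: (no_singular (g := g) (c := -1) (m := 0) irr w0).
    by rewrite gw addNr scale0r.
  split=> //; rewrite grade_unit_act gw linear0 add0r -glk -natr1.
  by congr (_ *: _); ring.
have f1w : unit_act pos4 pos2 w = 0.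
  apply: sing => // k l; elim/ord4_cases: k; elim/ord4_cases: l => // _.
  - exact: tx_f1w hw.
  - exact: ta_f1w hw.
  - by rewrite (e1_f1w rel hw) scale0r.
  - exact: e2_f1w hw.
  - exact: sg_f1w hw.
  - exact: ty_f1w hw.
have f2w : unit_act pos1 pos3 w = 0.
  apply: sing => // k l; elim/ord4_cases: k; elim/ord4_cases: l => // _.
  - exact: tx_f2w hw.
  - exact: ta_f2w hw.
  - exact: e1_f2w hw.
  - by rewrite (e2_f2w rel hw) oppr0 scale0r.
  - exact: sg_f2w hw.
  - exact: ty_f2w hw.
have := dw i; elim/ord4_cases: i; elim/ord4_cases: j => // _ dw'; try exact: dw'.
- exact: hook_e1 hw.
- exact: hook_e2 hw.
Qed.

End Gl22Module.

Theorem theorem2 (R : realType) (la : seq nat) (hla : hook11 la)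
    (V : gl22_module R) (hV : is_V la V) : k_spherical V.
Proof.
have [irr [w hwv]] := hV; have w0 := proj1 hwv; have hw := hook_vectorP hwv.
have rel := @unit_act_relations R V.
have [la0|] := posnP (nth 0%N la 0).
  suff b0 : (size la).-1 = 0%N.
    rewrite la0 b0 in hw; apply: (k_spherical_units w0) => i j.
    exact: trivial_hook_invariant.
  case: la hla la0 {hV hwv hw} => // a la /andP[/andP[_ +] _] /= a0.
  by rewrite a0 inE.
case: (nth 0%N la 0) hw => // n; move: (size la).-1 => b hw _.
have [Dn|nb] := eqVneq n b; last first.
  apply: (k_spherical_units (typical_neq0 rel hw nb (iter_y_neq0 rel hw w0))) => i j.
  exact/(exterior_top_invariant rel)/(zero_vec_weight rel hw).
rewrite {n}Dn in hw; apply: (k_spherical_units (atypical_neq0 rel hw w0)) => i j.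
apply: (atypical_invariant rel hw) => v sv.
(* The grading whose part of degree zero is [k]. *)
pose g (k : 'I_4) := nth 0%N [:: 0; 1; 0; 1]%N k.
have gE (u : carrier V) : grade g u = unit_act V pos2 pos2 u + unit_act V pos4 pos4 u.
  rewrite /grade (bigD1 pos2) // (bigD1 pos4) //= !scale1r big1 ?addr0 // => k.
  by elim/ord4_cases: k => // _; rewrite scale0r.
apply: (no_singular (g := g) (m := 0) irr w0 _ (c := (b.+1 + b)%:R - 1)).
  rewrite gE !(hook_has_weight hw) -scalerDl; congr (_ *: _).
  by rewrite /= natrD; ring.
split=> [|i' j']; first by rewrite gE (sing_degree sv).
elim/ord4_cases: i'; elim/ord4_cases: j' => // _.
- exact: sing_tx sv.
- exact: sing_ta sv.
- exact: sing_sg sv.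
- exact: sing_ty sv.
Qed.
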